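(* Among all unit-volume tetrahedra belonging to one of Goldberg's three infinite families, the one of least surface area is the Sommerville No. 1 tetrahedron of unit volume.
   Context: For a nondegenerate tetrahedron $V_1V_2V_3V_4$ in $\mathbb{R}^3$, let $d_{ij}$ be the length of the edge joining $V_i$ and $V_j$. Goldberg's families are the following sets of (nondegenerate) tetrahedra, up to congruence and relabeling of vertices, with sextuples $(d_{12},d_{13},d_{14},d_{23},d_{24},d_{34})$ and positive reals $a,b,c,d,f$. First family: $(b,c,a,b,c,b)$ with $a^2/3+b^2=c^2$. Second family: $(b,c,a/2,b,d,d)$ with $a^2/3+b^2=c^2$ and $a^2/12+d^2=b^2$. Third family: $(b,a,f,c,b/2,f)$ with $a^2/3+b^2=c^2$ and $b^2+2c^2=4f^2$. The Sommerville No. 1 is the tetrahedron, determined up to similarity, in which two opposite edges have length $2$ and the other four edges have length $\sqrt{3}$ (up to scaling). *)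

(* Defs.v *)
From HB Require Import structures.
From mathcomp Require Import all_boot all_order all_fingroup all_algebra.
From mathcomp Require Import reals.

Set Implicit Arguments.
Unset Strict Implicit.
Unset Printing Implicit Defensive.

Import Order.TTheory GRing.Theory Num.Theory.
Local Open Scope ring_scope.

Section Tetrahedra.
Variable R : realType.
Implicit Types (u v p q : 'rV[R]_3) (V : 'I_4 -> 'rV[R]_3).

Definition dotv u v : R := (u *m v^T) 0 0.

(* Euclidean norm; the norm that the libraries put on 'rV[R]_3 is the sup norm. *)
Definition enorm u : R := Num.sqrt (dotv u u).

Definition dist p q : R := enorm (q - p).

(* Rows: V_2 - V_1, V_3 - V_1, V_4 - V_1. *)
Definition edge_mx V : 'M[R]_3 := \matrix_(i < 3) (V (lift ord0 i) - V ord0).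

(* The vertices V_1, V_2, V_3, V_4 are indexed by 0, 1, 2, 3;
   nondegeneracy is affine independence of the vertices. *)
Record tetrahedron := Tetrahedron {
  vertex :> 'I_4 -> 'rV[R]_3;
  nondegenerate : \det (edge_mx vertex) != 0
}.

Implicit Type T : tetrahedron.

Definition volume T : R := `|\det (edge_mx T)| / 6.

(* Half the area |u|^2 |v|^2 - (u.v)^2 = |u x v|^2 of the parallelogram on
   the two sides u = q - p and v = r - p issued from p. *)
Definition triangle_area p q (r : 'rV[R]_3) : R :=
  Num.sqrt (enorm (q - p) ^+ 2 * enorm (r - p) ^+ 2
            - dotv (q - p) (r - p) ^+ 2) / 2.

(* The i-th summand is the area of the face opposite to vertex i. *)
Definition surface_area T : R :=
  \sum_(i < 4) triangle_area (T (lift i 0)) (T (lift i 1)) (T (lift i 2)).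

(* The edge lengths (d12, d13, d14, d23, d24, d34) once the vertices have been
   relabeled by s. *)
Definition edges T (s : {perm 'I_4}) : seq R :=
  [:: dist (T (s 0)) (T (s 1)); dist (T (s 0)) (T (s 2));
      dist (T (s 0)) (T (s 3)); dist (T (s 1)) (T (s 2));
      dist (T (s 1)) (T (s 3)); dist (T (s 2)) (T (s 3))].

(* Membership up to relabeling; invariance under congruence is automatic,
   only the edge lengths being involved. *)
Definition has_edges T (e : seq R) : Prop := exists s, edges T s = e.

Definition goldberg1 T : Prop :=
  exists a b c : R, [/\ 0 < a, 0 < b & 0 < c] /\
    a ^+ 2 / 3 + b ^+ 2 = c ^+ 2 /\
    has_edges T [:: b; c; a; b; c; b].

Definition goldberg2 T : Prop :=
  exists a b c d : R, [/\ 0 < a, 0 < b, 0 < c & 0 < d] /\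
    a ^+ 2 / 3 + b ^+ 2 = c ^+ 2 /\ a ^+ 2 / 12 + d ^+ 2 = b ^+ 2 /\
    has_edges T [:: b; c; a / 2; b; d; d].

Definition goldberg3 T : Prop :=
  exists a b c f : R, [/\ 0 < a, 0 < b, 0 < c & 0 < f] /\
    a ^+ 2 / 3 + b ^+ 2 = c ^+ 2 /\ b ^+ 2 + 2 * c ^+ 2 = 4 * f ^+ 2 /\
    has_edges T [:: b; a; f; c; b / 2; f].

Definition goldberg T : Prop := [\/ goldberg1 T, goldberg2 T | goldberg3 T].

Definition sommerville1 T : Prop :=
  exists k : R, 0 < k /\
    has_edges T [:: k * 2; k * Num.sqrt 3; k * Num.sqrt 3;
                    k * Num.sqrt 3; k * Num.sqrt 3; k * 2].

Definition least_area_goldberg T : Prop :=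
  [/\ goldberg T, volume T = 1
    & forall T', goldberg T' -> volume T' = 1 ->
        surface_area T <= surface_area T'].

End Tetrahedra.

(* Main.v *)
(* Put a = 3 h and b^2 = e^2 + h^2, so that c^2 = e^2 + 4 h^2: a member of the
   first family is inscribed in a right prism over an equilateral triangle of
   side e, and members of the other two families are halves of one. Then
   36 V^2 = 27/4 e^4 h^2 for the first family and 27/16 e^4 h^2 for the others,
   and every squared face area factors through e^2. Bounding below, by
   Cauchy-Schwarz, the areas that are not monomials in e and h gives
     S >= e^2 / sqrt 2 + 4 h e                        (first family),
     S >= e^2 / sqrt 2 + 9/4 h e                      (second family),
     S >= sqrt 2 / 4 e^2 + 13/4 h e                   (third family; 3 sqrt 3 >= 5),
   and by AM-GM at fixed e^2 h the right-hand sides are at least the area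
   4 sqrt 2 k^2, k^3 = 3/2, of the Sommerville tetrahedron, strictly for the last
   two. Equality in the first forces e^2 = 8 h^2, i.e. a = b, which is the
   Sommerville shape with the vertices V_2 and V_3 exchanged. *)
Require Import Defs.
From mathcomp Require Import all_boot all_order all_fingroup all_algebra.
From mathcomp Require Import reals.
From mathcomp Require Import ring lra.

Set Implicit Arguments.
Unset Strict Implicit.

Import Order.TTheory GRing.Theory Num.Theory.

Local Open Scope ring_scope.

Section Goldberg.
Variable R : realType.
Implicit Types (u v p q r : 'rV[R]_3) (V : 'I_4 -> 'rV[R]_3) (T : tetrahedron R).

(** * Scalar products, squared distances and face areas *)

Lemma dotvE u v : dotv u v = u 0 0 * v 0 0 + u 0 1 * v 0 1 + u 0 2 * v 0 2.
Proof.
rewrite /dotv mxE !big_ord_recl big_ord0 !mxE addr0 addrA.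
by congr (_ + _ * _ + _ * _); congr (_ _ _); apply: val_inj.
Qed.

Lemma dotv_ge0 u : 0 <= dotv u u.
Proof. by rewrite dotvE !addr_ge0 // -expr2 sqr_ge0. Qed.

Lemma enorm_sq u : enorm u ^+ 2 = dotv u u.
Proof. by rewrite sqr_sqrtr ?dotv_ge0. Qed.

Lemma distC p q : dist p q = dist q p.
Proof. by rewrite /dist /enorm !dotvE !mxE; congr Num.sqrt; ring. Qed.

Lemma distxx p : dist p p = 0.
Proof. by rewrite /dist /enorm dotvE subrr !mxE !mulr0 !addr0 sqrtr0. Qed.

Lemma polarization p q r :
  dotv (q - p) (r - p) =
  (dist p q ^+ 2 + dist p r ^+ 2 - dist q r ^+ 2) / 2.
Proof. by rewrite !enorm_sq !dotvE !mxE; field. Qed.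

Lemma lagrange_identity u v :
  dotv u u * dotv v v - dotv u v ^+ 2 =
  (u 0 0 * v 0 1 - u 0 1 * v 0 0) ^+ 2 + (u 0 0 * v 0 2 - u 0 2 * v 0 0) ^+ 2
  + (u 0 1 * v 0 2 - u 0 2 * v 0 1) ^+ 2.
Proof. by rewrite !dotvE; ring. Qed.

(** Heron's formula: in the squared sides of a triangle, this is sixteen times its squared area. *)
Definition heron (x y z : R) := 4 * x * y - (x + y - z) ^+ 2.

Lemma heron_dist p q r :
  heron (dist p q ^+ 2) (dist p r ^+ 2) (dist q r ^+ 2) =
  4 * (enorm (q - p) ^+ 2 * enorm (r - p) ^+ 2 - dotv (q - p) (r - p) ^+ 2).
Proof. by rewrite polarization /dist /heron; field. Qed.

Lemma heron_dist_ge0 p q r :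
  0 <= heron (dist p q ^+ 2) (dist p r ^+ 2) (dist q r ^+ 2).
Proof.
rewrite heron_dist !enorm_sq lagrange_identity mulr_ge0 //.
by rewrite !addr_ge0 ?sqr_ge0.
Qed.

Lemma triangle_areaE p q r :
  triangle_area p q r =
  Num.sqrt (heron (dist p q ^+ 2) (dist p r ^+ 2) (dist q r ^+ 2)) / 4.
Proof.
rewrite heron_dist sqrtrM // (_ : 4 = 2 ^+ 2 :> R); last by ring.
by rewrite sqrtr_sqr ger0_norm // /triangle_area; field.
Qed.

Lemma sum_lift (F : 'I_4 -> R) i :
  \sum_j F j = F i + F (lift i 0) + F (lift i 1) + F (lift i 2).
Proof.
rewrite (bigD1_ord i) //= !big_ord_recl big_ord0 addr0 !addrA.
by congr (_ + F _ + F _ + F _); congr lift; apply: val_inj.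
Qed.

(* A form of the face areas in which the vertices play symmetric roles. *)
Lemma surface_areaE T (D := fun i j => dist (T i) (T j) ^+ 2) :
  surface_area T =
  \sum_i Num.sqrt ((\sum_j \sum_k D j k - 2 * \sum_j D i j) ^+ 2 / 4
    - (\sum_j \sum_k D j k ^+ 2 - 2 * \sum_j D i j ^+ 2)) / 4.
Proof.
apply: eq_bigr => i _; rewrite triangle_areaE.
have Dxx j : D j j = 0 by rewrite /D distxx expr0n.
have DC j k : D j k = D k j by rewrite /D distC.
congr (Num.sqrt _ / 4).
(* Each double sum minus twice the star of [i] counts every edge of the opposite face twice, and
   [heron x y z] is the symmetric form [(x + y + z) ^+ 2 - 2 * (x ^+ 2 + y ^+ 2 + z ^+ 2)]. *)
rewrite !(sum_lift _ i) !Dxx -/(D _ _) /heron.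
rewrite !(DC (lift i _) i) (DC (lift i 1) (lift i 0)).
rewrite !(DC (lift i 2) (lift i _)) -!/(D _ _).
by field.
Qed.

(** * Determinants and invariance under relabeling *)

Lemma det_mx33 (A : 'M[R]_3) :
  \det A = A 0 0 * (A 1 1 * A 2 2 - A 1 2 * A 2 1)
         - A 0 1 * (A 1 0 * A 2 2 - A 1 2 * A 2 0)
         + A 0 2 * (A 1 0 * A 2 1 - A 1 1 * A 2 0).
Proof.
have o1 : lift 0 0 = 1 :> 'I_3 by apply: val_inj.
have o2 : lift 0 1 = 2 :> 'I_3 by apply: val_inj.
have o3 : lift 1 0 = 0 :> 'I_3 by apply: val_inj.
have o4 : lift 1 1 = 2 :> 'I_3 by apply: val_inj.
have o5 : lift 2 0 = 0 :> 'I_3 by apply: val_inj.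
have o6 : lift 2 1 = 1 :> 'I_3 by apply: val_inj.
have o7 : lift 0 0 = 1 :> 'I_2 by apply: val_inj.
have o8 : lift 1 0 = 0 :> 'I_2 by apply: val_inj.
rewrite (expand_det_row A 0) !big_ord_recl big_ord0 o7 o1 o2 /cofactor.
rewrite !(expand_det_row _ 0) !big_ord_recl !big_ord0 /cofactor !det_mx11 !mxE.
rewrite !(o1, o2, o3, o4, o5, o6, o7, o8) /=.
by ring.
Qed.

(** [edge_mx] singles out the first vertex; with homogeneous coordinates a relabeling is a mere
    permutation of rows. *)
Definition homogeneous_mx V : 'M[R]_(1 + 3) := \matrix_i row_mx 1%:M (V i).

Lemma det_homogeneous_mx V : \det (homogeneous_mx V) = \det (edge_mx V).
Proof.
have MV : homogeneous_mx V =
    block_mx 1%:M (V 0) (const_mx 1) (\matrix_(i < 3) V (lift 0 i)).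
  rewrite -[LHS]submxK; congr block_mx; apply/matrixP => i j; rewrite !mxE.
  - by rewrite (unsplitK (inl j)) mxE (ord1 i).
  - rewrite (unsplitK (inr j)) (ord1 i).
    by congr (V _ _ _); apply: val_inj.
  - by rewrite (unsplitK (inl j)) mxE (ord1 j).
  - by rewrite (unsplitK (inr j)); congr (V _ _ _); apply: val_inj.
(* Multiplying by [L] subtracts the first row from the others, which leaves a block triangular
   matrix with [edge_mx V] in the corner. *)
pose L : 'M[R]_(1 + 3) := block_mx 1%:M 0 (const_mx (-1)) 1%:M.
have detL : \det L = 1 by rewrite det_lblock !det1 mulr1.
rewrite -[LHS]mul1r -detL -det_mulmx MV mulmx_block !mul1mx !mul0mx !addr0.
have -> : const_mx (-1) *m 1%:M + const_mx 1 = 0 :> 'M[R]_(3, 1).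
  by apply/matrixP => i j; rewrite mulmx1 !mxE addNr.
rewrite det_ublock det1 mul1r; congr (\det _); apply/matrixP => i j.
by rewrite !mxE big_ord1 !mxE mulN1r addrC.
Qed.

Lemma det_edge_mx_perm V (s : {perm 'I_4}) :
  \det (edge_mx (V \o s)) = (-1) ^+ s * \det (edge_mx V).
Proof.
rewrite -!det_homogeneous_mx -det_perm -det_mulmx -row_permE; congr (\det _).
by apply/matrixP => i j; rewrite !mxE.
Qed.

Lemma relabel_nondegenerate T (s : {perm 'I_4}) :
  \det (edge_mx (T \o s)) != 0.
Proof.
rewrite det_edge_mx_perm mulf_neq0 ?signr_eq0 //; exact: Defs.nondegenerate.
Qed.

Definition relabel T s := Tetrahedron (relabel_nondegenerate T s).

Lemma volume_relabel T s : volume (relabel T s) = volume T.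
Proof. by rewrite /volume det_edge_mx_perm normrM normrX normrN1 expr1n mul1r. Qed.

Lemma surface_area_relabel T s : surface_area (relabel T s) = surface_area T.
Proof.
have sum_perm (F : 'I_4 -> R) : \sum_j F (s j) = \sum_j F j.
  by rewrite [RHS](reindex_inj (@perm_inj _ s)).
pose D i j := dist (T i) (T j) ^+ 2.
have sum2_perm (F : 'I_4 -> 'I_4 -> R) :
    \sum_j \sum_k F (s j) (s k) = \sum_j \sum_k F j k.
  by rewrite -[RHS]sum_perm; apply: eq_bigr => j _; rewrite sum_perm.
rewrite !surface_areaE -[RHS]sum_perm; apply: eq_bigr => i _.
rewrite (sum2_perm D) (sum2_perm (fun j k => D j k ^+ 2)).
by rewrite (sum_perm (D (s i))) (sum_perm (fun j => D (s i) j ^+ 2)).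
Qed.

(** * Volume and surface area as functions of the edge lengths *)

Definition gram (x12 x13 x14 x23 x24 x34 : R) :=
  let g12 := (x12 + x13 - x23) / 2 in
  let g13 := (x12 + x14 - x24) / 2 in
  let g23 := (x13 + x14 - x34) / 2 in
  x12 * (x13 * x14 - g23 ^+ 2) - g12 * (g12 * x14 - g23 * g13)
  + g13 * (g12 * g23 - x13 * g13).

(** [gram] is the Gram determinant of the three edges issued from the first vertex, with scalar
    products replaced by squared lengths through [polarization]. *)
Lemma det_edge_mx_sq V :
  \det (edge_mx V) ^+ 2 =
  gram (dist (V 0) (V 1) ^+ 2) (dist (V 0) (V 2) ^+ 2) (dist (V 0) (V 3) ^+ 2)
       (dist (V 1) (V 2) ^+ 2) (dist (V 1) (V 3) ^+ 2) (dist (V 2) (V 3) ^+ 2).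
Proof.
have o1 : lift ord0 0 = 1 :> 'I_4 by apply: val_inj.
have o2 : lift ord0 1 = 2 :> 'I_4 by apply: val_inj.
have o3 : lift ord0 2 = 3 :> 'I_4 by apply: val_inj.
rewrite /gram -!polarization /dist !enorm_sq !dotvE det_mx33 !mxE o1 o2 o3.
by ring.
Qed.

Definition area_of_edges (x12 x13 x14 x23 x24 x34 : R) :=
  (Num.sqrt (heron x23 x24 x34) + Num.sqrt (heron x13 x14 x34)
   + Num.sqrt (heron x12 x14 x24) + Num.sqrt (heron x12 x13 x23)) / 4.

Lemma surface_area_faces T :
  surface_area T =
    triangle_area (T 1) (T 2) (T 3) + triangle_area (T 0) (T 2) (T 3)
    + triangle_area (T 0) (T 1) (T 3) + triangle_area (T 0) (T 1) (T 2).
Proof.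
have lift_eq (i : 'I_4) (j : 'I_3) (k : 'I_4) : bump i j = k -> lift i j = k.
  by move=> ?; apply: val_inj.
rewrite /surface_area !big_ord_recl big_ord0 addr0 !addrA.
rewrite (lift_eq ord0 0 1) // (lift_eq ord0 1 2) // (lift_eq ord0 2 3) //.
rewrite !(lift_eq _ 0 0) // (lift_eq _ 1 2) // (lift_eq _ 2 3) //.
rewrite !(lift_eq _ 1 1) // (lift_eq _ 2 3) // (lift_eq _ 2 2) //.
Qed.

(** The last clause, about the face V_1 V_2 V_4, later yields [0 <= b ^+ 2 - a ^+ 2 / 9] in each
    family. *)
Lemma has_edgesP T x12 x13 x14 x23 x24 x34 :
  has_edges T [:: x12; x13; x14; x23; x24; x34] ->
  [/\ (6 * volume T) ^+ 2 =
        gram (x12 ^+ 2) (x13 ^+ 2) (x14 ^+ 2) (x23 ^+ 2) (x24 ^+ 2) (x34 ^+ 2),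
      surface_area T = area_of_edges
        (x12 ^+ 2) (x13 ^+ 2) (x14 ^+ 2) (x23 ^+ 2) (x24 ^+ 2) (x34 ^+ 2)
    & 0 <= heron (x12 ^+ 2) (x14 ^+ 2) (x24 ^+ 2)].
Proof.
case=> s [<- <- <- <- <- <-].
rewrite -(volume_relabel T s) -(surface_area_relabel T s); split.
- rewrite -(det_edge_mx_sq (T \o s)) /volume mulrC divfK ?pnatr_eq0 //.
  by rewrite real_normK ?num_real.
- rewrite surface_area_faces !triangle_areaE -!mulrDl.
  by rewrite /area_of_edges.
- exact: heron_dist_ge0.
Qed.

(** The first family has its opposite edges [c] at V_1 V_3 and V_2 V_4, the Sommerville sextuple its
    long edges at V_1 V_2 and V_3 V_4; this exchange matches them. *)
Lemma has_edges_swap23 T x12 x13 x14 x23 x24 x34 :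
  has_edges T [:: x12; x13; x14; x23; x24; x34] ->
  has_edges T [:: x13; x12; x14; x23; x34; x24].
Proof.
case=> s [<- <- <- <- <- <-]; exists (tperm 1%R 2%R * s)%g; rewrite /edges !permM.
by rewrite tpermL tpermR !tpermD // (distC (T (s 2)) (T (s 1))).
Qed.

(** * AM-GM and lower bounds for the areas in the three families *)

Lemma am_gm_eq (x y m : R) : 0 <= x -> 0 <= y -> 0 < m ->
  m ^+ 3 <= x * y ^+ 2 -> x + 2 * y <= 3 * m -> x = m /\ y = m.
Proof.
move=> x0 y0 m0 mxy xym.
have tm : (x + 2 * y) ^+ 3 <= (3 * m) ^+ 3.
  by rewrite lerXn2r // ?nnegrE; lra.
(* The deficit in AM-GM for [x], [y], [y] has a square factor; the hypotheses reverse the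
   inequality, so this deficit vanishes. *)
have amgm : (x + 2 * y) ^+ 3 - 27 * (x * y ^+ 2) = (x - y) ^+ 2 * (x + 8 * y).
  by ring.
have prod_ge0 : 0 <= (x - y) ^+ 2 * (x + 8 * y).
  by rewrite mulr_ge0 ?sqr_ge0 //; lra.
have m27 : (3 * m) ^+ 3 = 27 * m ^+ 3 by ring.
have prod0 : (x - y) ^+ 2 * (x + 8 * y) = 0 by lra.
have xy : x = y.
  move/eqP: prod0; rewrite mulf_eq0 sqrf_eq0 subr_eq0 => /orP[/eqP //|/eqP]; lra.
have : m <= y.
  rewrite -(@ler_pXn2r _ 3) ?nnegrE //; last exact: ltW.
  by rewrite (exprS y 2) -{1}xy.
by rewrite xy in xym *; lra.
Qed.

(* Cauchy-Schwarz for (e, 2h) and (sqrt 8, 2), with equality when e^2 = 8 h^2. *)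
Lemma sqrt_base_ge (e h : R) :
  Num.sqrt 2 * e ^+ 2 + 2 * h * e <= Num.sqrt (3 * e ^+ 2 * (e ^+ 2 + 4 * h ^+ 2)).
Proof.
have r2 : Num.sqrt 2 ^+ 2 = 2 :> R by rewrite sqr_sqrtr.
apply: le_trans (ler_norm _) _; rewrite -sqrtr_sqr ler_wsqrtr //.
rewrite -subr_ge0.
have -> : 3 * e ^+ 2 * (e ^+ 2 + 4 * h ^+ 2) - (Num.sqrt 2 * e ^+ 2 + 2 * h * e) ^+ 2
  = (e * (e - 2 * Num.sqrt 2 * h)) ^+ 2 by ring: r2.
exact: sqr_ge0.
Qed.

Lemma sqrt_side_ge (c e h : R) :
  c * h * e <= Num.sqrt (c ^+ 2 * h ^+ 2 * e ^+ 2).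
Proof. by rewrite -!exprMn sqrtr_sqr ler_norm. Qed.

(** Since [Num.sqrt] is zero on negative numbers, the sign hypothesis is what lets [e] have the
    required square. *)
Lemma prism_parameters (a b c : R) :
  0 < a -> a ^+ 2 / 3 + b ^+ 2 = c ^+ 2 -> 0 <= b ^+ 2 - a ^+ 2 / 9 ->
  exists e h, [/\ 0 <= e, 0 < h, a = 3 * h,
    b ^+ 2 = e ^+ 2 + h ^+ 2 & c ^+ 2 = e ^+ 2 + 4 * h ^+ 2].
Proof.
move=> a0 <- E0; exists (Num.sqrt (b ^+ 2 - a ^+ 2 / 9)), (a / 3).
by rewrite sqr_sqrtr // sqrtr_ge0 divr_gt0 //; split=> //; field.
Qed.

Lemma goldberg1_area_ge (e h : R) :
  Num.sqrt 2 * e ^+ 2 + 8 * (h * e) <=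
  2 * area_of_edges (e ^+ 2 + h ^+ 2) (e ^+ 2 + 4 * h ^+ 2) (9 * h ^+ 2)
    (e ^+ 2 + h ^+ 2) (e ^+ 2 + 4 * h ^+ 2) (e ^+ 2 + h ^+ 2).
Proof.
pose base := Num.sqrt (3 * e ^+ 2 * (e ^+ 2 + 4 * h ^+ 2)).
pose side := Num.sqrt (6 ^+ 2 * h ^+ 2 * e ^+ 2).
have -> : area_of_edges (e ^+ 2 + h ^+ 2) (e ^+ 2 + 4 * h ^+ 2) (9 * h ^+ 2)
    (e ^+ 2 + h ^+ 2) (e ^+ 2 + 4 * h ^+ 2) (e ^+ 2 + h ^+ 2)
  = (base + side + side + base) / 4.
  rewrite /area_of_edges /base /side /heron.
  by congr ((Num.sqrt _ + Num.sqrt _ + Num.sqrt _ + Num.sqrt _) / 4); ring.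
have := sqrt_base_ge e h; have := sqrt_side_ge 6 e h.
by rewrite -/base -/side; lra.
Qed.

Lemma goldberg2_area_ge (e h : R) :
  2 * Num.sqrt 2 * e ^+ 2 + 9 * (h * e) <=
  4 * area_of_edges (e ^+ 2 + h ^+ 2) (e ^+ 2 + 4 * h ^+ 2) (9 / 4 * h ^+ 2)
    (e ^+ 2 + h ^+ 2) (e ^+ 2 + h ^+ 2 / 4) (e ^+ 2 + h ^+ 2 / 4).
Proof.
pose base := Num.sqrt (3 * e ^+ 2 * (e ^+ 2 + 4 * h ^+ 2)).
(* The face V_2 V_3 V_4 obeys the base formula with [h] halved, so [sqrt_base_ge] bounds it too. *)
pose half_base := Num.sqrt (3 * e ^+ 2 * (e ^+ 2 + 4 * (h / 2) ^+ 2)).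
pose side := Num.sqrt (3 ^+ 2 * h ^+ 2 * e ^+ 2).
have -> : area_of_edges (e ^+ 2 + h ^+ 2) (e ^+ 2 + 4 * h ^+ 2) (9 / 4 * h ^+ 2)
    (e ^+ 2 + h ^+ 2) (e ^+ 2 + h ^+ 2 / 4) (e ^+ 2 + h ^+ 2 / 4)
  = (half_base + side + side + base) / 4.
  rewrite /area_of_edges /half_base /base /side /heron.
  by congr ((Num.sqrt _ + Num.sqrt _ + Num.sqrt _ + Num.sqrt _) / 4); field.
have := sqrt_base_ge e h; have := sqrt_base_ge e (h / 2).
have := sqrt_side_ge 3 e h.
by rewrite -/base -/half_base -/side; lra.
Qed.

Lemma goldberg3_area_ge (e h : R) : 0 <= e -> 0 <= h ->
  Num.sqrt 2 * e ^+ 2 + 13 * (h * e) <=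
  4 * area_of_edges (e ^+ 2 + h ^+ 2) (9 * h ^+ 2) ((3 * e ^+ 2 + 9 * h ^+ 2) / 4)
    (e ^+ 2 + 4 * h ^+ 2) ((e ^+ 2 + h ^+ 2) / 4) ((3 * e ^+ 2 + 9 * h ^+ 2) / 4).
Proof.
move=> e0 h0.
pose base := Num.sqrt (3 * e ^+ 2 * (e ^+ 2 + 4 * h ^+ 2)).
pose side := Num.sqrt (6 ^+ 2 * h ^+ 2 * e ^+ 2).
pose slant := Num.sqrt (27 * h ^+ 2 * e ^+ 2).
have half_base : Num.sqrt (3 / 4 * e ^+ 2 * (e ^+ 2 + 4 * h ^+ 2)) = base / 2.
  have -> : 3 / 4 * e ^+ 2 * (e ^+ 2 + 4 * h ^+ 2)
      = 2^-1 ^+ 2 * (3 * e ^+ 2 * (e ^+ 2 + 4 * h ^+ 2)) by field.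
  by rewrite sqrtrM ?sqr_ge0 // sqrtr_sqr ger0_norm ?invr_ge0 // mulrC.
have -> : area_of_edges (e ^+ 2 + h ^+ 2) (9 * h ^+ 2)
    ((3 * e ^+ 2 + 9 * h ^+ 2) / 4) (e ^+ 2 + 4 * h ^+ 2)
    ((e ^+ 2 + h ^+ 2) / 4) ((3 * e ^+ 2 + 9 * h ^+ 2) / 4)
  = (base / 2 + slant + base / 2 + side) / 4.
  rewrite -half_base /area_of_edges /slant /side /heron.
  by congr ((Num.sqrt _ + Num.sqrt _ + Num.sqrt _ + Num.sqrt _) / 4); field.
(* Here 27 is weakened to the perfect square 25. *)
have slant_ge : 5 * h * e <= slant.
  apply: le_trans (sqrt_side_ge 5 e h) _; rewrite ler_wsqrtr //.
  by rewrite !ler_wpM2r ?sqr_ge0 // -natrX ler_nat.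
have := sqrt_base_ge e h; have := sqrt_side_ge 6 e h.
by rewrite -/base -/side; lra.
Qed.

(** * Comparison with the Sommerville area, family by family *)

Lemma sommerville_of_area_le T (k : R) :
  0 < k -> k ^+ 3 = 3 / 2 -> volume T = 1 ->
  surface_area T <= 4 * Num.sqrt 2 * k ^+ 2 -> goldberg T -> sommerville1 T.
Proof.
move=> k0 k3 vol areaT.
set r := Num.sqrt 2 in areaT.
have r0 : 0 < r by rewrite sqrtr_gt0.
have r2 : r ^+ 2 = 2 by rewrite sqr_sqrtr.
(* A third of the comparison area, so that the area bound takes the form [x + 2 * y <= 3 * m]. *)
pose m := 4 / 3 * r * k ^+ 2.
have m0 : 0 < m by rewrite !mulr_gt0 ?exprn_gt0 ?invr_gt0.
have m3 : m ^+ 3 = 32 / 3 * r.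
  have -> : m ^+ 3 = 64 / 27 * r ^+ 2 * r * (k ^+ 3) ^+ 2 by rewrite /m; field.
  by rewrite r2 k3; field.
case=> [[a [b [c [[a0 b0 c0] [abc edgesT]]]]]
       |[a [b [c [d [[a0 b0 c0 d0] [abc [abd edgesT]]]]]]]
       |[a [b [c [f [[a0 b0 c0 f0] [abc [bcf edgesT]]]]]]]].
- have [] := has_edgesP edgesT; rewrite vol => volE areaE heronE.
  have [|e [h [e0 h0 ah bE cE]]] := prism_parameters a0 abc.
    (* The Heron expression of V_1 V_2 V_4 is [4 * a ^+ 2] times the wanted quantity; the other
       families differ only in the positive factor. *)
    rewrite -(pmulr_rge0 _ (_ : 0 < 4 * a ^+ 2)) ?mulr_gt0 ?exprn_gt0 //.
    by move: heronE; rewrite -abc /heron; congr (0 <= _); field.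
  have aE : a ^+ 2 = 9 * h ^+ 2 by rewrite ah; ring.
  rewrite {}areaE {heronE} aE bE cE in areaT volE.
  have area_ge := le_trans (goldberg1_area_ge e h) (ler_wpM2l (ler0n R 2) areaT).
  (* With this split [x * y ^+ 2] is a multiple of [e ^+ 4 * h ^+ 2], which the volume fixes; here
     it equals [m ^+ 3] exactly. *)
  have [|||||xm ym] := @am_gm_eq (r / 2 * e ^+ 2) (2 * (h * e)) m.
  + by rewrite !mulr_ge0 ?invr_ge0 // ltW.
  + by rewrite !mulr_ge0 // ltW.
  + exact: m0.
  + rewrite m3.
    have -> : r / 2 * e ^+ 2 * (2 * (h * e)) ^+ 2
        = 8 / 27 * r * (27 / 4 * (e ^+ 2 * h) ^+ 2) by field.
    have -> : 27 / 4 * (e ^+ 2 * h) ^+ 2 = (6 * 1) ^+ 2.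
      by rewrite volE /gram; field.
    lra.
  + by move: area_ge; rewrite -/r /m; lra.
  have e_gt0 : 0 < e.
    rewrite lt_def e0 andbT; apply: contraTneq m0 => e_eq0.
    by rewrite -ym e_eq0 !mulr0 ltxx.
  have eh : r * e = 4 * h.
    apply: (mulIf (lt0r_neq0 e_gt0)); apply: (mulIf (_ : 2^-1 != 0)).
      by rewrite invr_eq0 pnatr_eq0.
    by transitivity (r / 2 * e ^+ 2); [field | rewrite xm -ym; field].
  have e2 : e ^+ 2 = 8 * h ^+ 2.
    have : (r * e) ^+ 2 = (4 * h) ^+ 2 by rewrite eh.
    by rewrite !exprMn r2; lra.
  (* Now [b ^+ 2 = 9 * h ^+ 2 = a ^+ 2] and [c ^+ 2 = 12 * h ^+ 2], so the edges [c] are the two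
     long ones. *)
  exists (c / 2); split; first by rewrite divr_gt0.
  have h3 : b = 3 * h.
    apply/eqP; rewrite -(@eqrXn2 _ 2) ?ltW //; last by lra.
    by rewrite bE e2; apply/eqP; ring.
  have c3 : b = c / 2 * Num.sqrt 3.
    apply/eqP; rewrite -(@eqrXn2 _ 2) ?ltW // ?mulr_gt0 ?invr_gt0 ?sqrtr_gt0 //.
    by rewrite !exprMn sqr_sqrtr // exprVn bE cE e2; apply/eqP; field.
  have c2 : c = c / 2 * 2 by field.
  by rewrite -c3 -c2; apply: has_edges_swap23; rewrite h3 -ah in edgesT *.
- have [] := has_edgesP edgesT; rewrite vol => volE areaE heronE; exfalso.
  have dE : d ^+ 2 = b ^+ 2 - a ^+ 2 / 12 by lra.
  have [|e [h [e0 h0 ah bE cE]]] := prism_parameters a0 abc.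
    rewrite -(pmulr_rge0 _ (_ : 0 < a ^+ 2)) ?exprn_gt0 //.
    by move: heronE; rewrite dE /heron; congr (0 <= _); field.
  have aE : (a / 2) ^+ 2 = 9 / 4 * h ^+ 2 by rewrite ah; field.
  have {}dE : d ^+ 2 = e ^+ 2 + h ^+ 2 / 4 by rewrite dE bE ah; field.
  rewrite {}areaE {heronE} aE bE cE dE in areaT volE.
  have area_ge := le_trans (goldberg2_area_ge e h) (ler_wpM2l (ler0n R 4) areaT).
  (* As 27/2 exceeds 32/3, this product is larger than [m ^+ 3], contradicting the equality case
     [x = y = m]. *)
  have xy : r / 2 * e ^+ 2 * (9 / 8 * (h * e)) ^+ 2 = 27 / 2 * r.
    have -> : r / 2 * e ^+ 2 * (9 / 8 * (h * e)) ^+ 2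
        = 3 / 8 * r * (27 / 16 * (e ^+ 2 * h) ^+ 2) by field.
    have -> : 27 / 16 * (e ^+ 2 * h) ^+ 2 = (6 * 1) ^+ 2.
      by rewrite volE /gram; field.
    by field.
  have [|||||xm ym] := @am_gm_eq (r / 2 * e ^+ 2) (9 / 8 * (h * e)) m.
  + by rewrite !mulr_ge0 ?invr_ge0 // ltW.
  + by rewrite !mulr_ge0 ?invr_ge0 // ltW.
  + exact: m0.
  + by rewrite m3 xy; lra.
  + by move: area_ge; rewrite -/r /m; lra.
  by move: xy; rewrite xm ym -exprS m3; lra.
- have [] := has_edgesP edgesT; rewrite vol => volE areaE heronE; exfalso.
  have fE : f ^+ 2 = (3 * b ^+ 2 + 2 / 3 * a ^+ 2) / 4 by lra.
  have [|e [h [e0 h0 ah bE cE]]] := prism_parameters a0 abc.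
    rewrite -(pmulr_rge0 _ (_ : 0 < 3 / 4 * c ^+ 2)); last first.
      by rewrite !mulr_gt0 ?invr_gt0 ?exprn_gt0.
    by move: heronE; rewrite fE -abc /heron; congr (0 <= _); field.
  have aE : a ^+ 2 = 9 * h ^+ 2 by rewrite ah; ring.
  have {}fE : f ^+ 2 = (3 * e ^+ 2 + 9 * h ^+ 2) / 4 by rewrite fE bE ah; field.
  have b2E : (b / 2) ^+ 2 = (e ^+ 2 + h ^+ 2) / 4 by rewrite -bE; field.
  rewrite {}areaE {heronE} aE b2E bE cE fE in areaT volE.
  have area_ge := le_trans (goldberg3_area_ge e0 (ltW h0))
    (ler_wpM2l (ler0n R 4) areaT).
  (* The same contradiction, since 169/12 exceeds 32/3. *)
  have xy : r / 4 * e ^+ 2 * (13 / 8 * (h * e)) ^+ 2 = 169 / 12 * r.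
    have -> : r / 4 * e ^+ 2 * (13 / 8 * (h * e)) ^+ 2
        = 169 / 432 * r * (27 / 16 * (e ^+ 2 * h) ^+ 2) by field.
    have -> : 27 / 16 * (e ^+ 2 * h) ^+ 2 = (6 * 1) ^+ 2.
      by rewrite volE /gram; field.
    by field.
  have [|||||xm ym] := @am_gm_eq (r / 4 * e ^+ 2) (13 / 8 * (h * e)) m.
  + by rewrite !mulr_ge0 ?invr_ge0 // ltW.
  + by rewrite !mulr_ge0 ?invr_ge0 // ltW.
  + exact: m0.
  + by rewrite m3 xy; lra.
  + by move: area_ge; rewrite -/r /m; lra.
  by move: xy; rewrite xm ym -exprS m3; lra.
Qed.

(** * The Sommerville tetrahedron: membership, area and existence *)

Lemma sommerville1_goldberg T : sommerville1 T -> goldberg T.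
Proof.
case=> k [k0 edgesT]; apply: Or31.
have r0 : 0 < Num.sqrt 3 :> R by rewrite sqrtr_gt0.
(* It is the member of the first family with [a = b]. *)
exists (k * Num.sqrt 3), (k * Num.sqrt 3), (k * 2).
split; first by rewrite !mulr_gt0.
split; last exact: has_edges_swap23.
by rewrite !exprMn sqr_sqrtr //; field.
Qed.

Lemma sommerville1_area T : sommerville1 T -> volume T = 1 ->
  exists k : R, [/\ 0 < k, k ^+ 3 = 3 / 2
    & surface_area T = 4 * Num.sqrt 2 * k ^+ 2].
Proof.
case=> k [k0 edgesT] vol; exists k.
have [] := has_edgesP edgesT; rewrite vol !exprMn sqr_sqrtr // => volE -> _.
split=> //.
  apply/eqP; rewrite -(@eqrXn2 _ 2) ?ltW ?exprn_gt0 ?divr_gt0 //; apply/eqP.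
  have : (4 * k ^+ 3) ^+ 2 = 6 ^+ 2 * 1 ^+ 2 by rewrite volE /gram; field.
  by rewrite exprMn; lra.
(* All four faces have squared sides 4, 3, 3 times [k ^+ 2], hence Heron expression
   [32 * k ^+ 4]. *)
have face : Num.sqrt (4 ^+ 2 * 2 * k ^+ 2 ^+ 2) = 4 * Num.sqrt 2 * k ^+ 2.
  have face_ge0 : 0 <= 4 * Num.sqrt 2 * k ^+ 2.
    by rewrite !mulr_ge0 ?exprn_ge0 ?sqrtr_ge0 ?ltW.
  rewrite -[RHS](ger0_norm face_ge0) -sqrtr_sqr; congr Num.sqrt.
  by rewrite !exprMn sqr_sqrtr.
pose S := 4 * Num.sqrt 2 * k ^+ 2; rewrite -/S in face *.
transitivity ((S + S + S + S) / 4); last by field.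
rewrite -face /area_of_edges /heron.
by congr ((Num.sqrt _ + Num.sqrt _ + Num.sqrt _ + Num.sqrt _) / 4); ring.
Qed.

Lemma exists_unit_sommerville1 :
  exists T : tetrahedron R, sommerville1 T /\ volume T = 1.
Proof.
(* The volume at scale [k] is [2 / 3 * k ^+ 3], so [k] must be a cube root of 3/2. *)
have [k /andP[k0 _] rootk] : exists2 k : R, 0 <= k <= 2 & root ('X^3 - (3 / 2)%:P) k.
  apply: poly_ivt => //; rewrite !hornerE; apply/andP; split; lra.
have k3 : k ^+ 3 = 3 / 2.
  by move: rootk; rewrite /root !hornerE subr_eq0 => /eqP.
have k_gt0 : 0 < k.
  rewrite lt_def k0 andbT; apply/eqP => k_eq0; move: k3; rewrite k_eq0 expr0n /=; lra.
pose row3 (x y z : R) : 'rV[R]_3 := \row_j [:: x; y; z]`_j.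
(* The two edges of length [2 * k] are put in perpendicular directions, with midpoints at distance
   [k] on the third axis. *)
pose V : 'I_4 -> 'rV[R]_3 := fun i =>
  nth 0 [:: row3 k 0 0; row3 (- k) 0 0; row3 0 k k; row3 0 (- k) k] i.
have o1 : lift ord0 0 = 1 :> 'I_4 by apply: val_inj.
have o2 : lift ord0 1 = 2 :> 'I_4 by apply: val_inj.
have o3 : lift ord0 2 = 3 :> 'I_4 by apply: val_inj.
have detV : \det (edge_mx V) = - 6.
  have edgeE i j : edge_mx V i j = V (lift ord0 i) 0 j - V ord0 0 j.
    by rewrite /edge_mx 3!mxE.
  rewrite det_mx33 !edgeE o1 o2 o3 /V /= !mxE /=.
  by transitivity (- 4 * k ^+ 3); [ring | rewrite k3; field].
have ndV : \det (edge_mx V) != 0 by rewrite detV oppr_eq0 pnatr_eq0.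
exists (Tetrahedron ndV); split; last first.
  by rewrite /volume /= detV normrN normr_nat divff ?pnatr_eq0.
exists k; split=> //; exists 1%g; rewrite /edges !perm1 /=.
have dist_eq p q (x : R) : 0 <= x -> dotv (q - p) (q - p) = x ^+ 2 -> dist p q = x.
  by move=> x0; rewrite /dist /enorm => ->; rewrite sqrtr_sqr ger0_norm.
have s3 : Num.sqrt 3 ^+ 2 = 3 :> R by rewrite sqr_sqrtr.
congr [:: _; _; _; _; _; _]; apply: dist_eq; rewrite ?mulr_ge0 ?sqrtr_ge0 //;
  rewrite dotvE !mxE /V /= ?exprMn ?s3; ring.
Qed.

End Goldberg.

Theorem theorem3p6 (R : realType) :
  (exists T : tetrahedron R, sommerville1 T /\ volume T = 1) /\
  (forall T : tetrahedron R,
     least_area_goldberg T <-> sommerville1 T /\ volume T = 1).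
Proof.
have [T0 [somT0 volT0]] := exists_unit_sommerville1 R.
have [k [k0 k3 areaT0]] := sommerville1_area somT0 volT0.
split; first by exists T0.
move=> T; split=> [[golT volT leastT] | [somT volT]].
  split=> //; apply: (sommerville_of_area_le k0 k3 volT) => //.
  by rewrite -areaT0; apply: leastT => //; exact: sommerville1_goldberg.
split=> //; first exact: sommerville1_goldberg.
have [l [l0 l3 ->]] := sommerville1_area somT volT.
(* A strictly smaller competitor would itself be a Sommerville tetrahedron; unit volume fixes its
   scale, hence its area, a contradiction. *)
move=> T' golT' volT'; rewrite leNgt; apply/negP => lt_area.
have somT' := sommerville_of_area_le l0 l3 volT' (ltW lt_area) golT'.
have [n [n0 n3 areaT']] := sommerville1_area somT' volT'.
have nl : n = l.
  by apply/eqP; rewrite -(@eqrXn2 _ 3) ?ltW // n3 l3.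
by move: lt_area; rewrite areaT' nl ltxx.
Qed.
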